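(* Let $0<\xi\le1$ and $w_1,\dots,w_d>0$. Let $\mathcal J$ be a collection of non-empty subsets of $\{1,\dots,d\}$ and let $\boldsymbol c=(c_J)_{J\in\mathcal J}$ be non-negative constants that are extremal coefficients, i.e. $c_J=\int_{\mathbb S_+}\max_{j\in J}u_j\,H_0(d\boldsymbol u)$, $J\in\mathcal J$, for some finite Borel measure $H_0$ on $\mathbb S_+$. Let $(\mathcal L_\rho)$ and $(\mathcal U_\rho)$ be, respectively, the problems of finding the infimum and the supremum of $$\rho_{\boldsymbol w}(H,\xi)=\int_{\mathbb S_+}\big(w_1u_1^\xi+\cdots+w_du_d^\xi\big)^{1/\xi}H(d\boldsymbol u)$$ over all finite Borel measures $H$ on $\mathbb S_+$ satisfying $\int_{\mathbb S_+}\max_{j\in J}u_j\,H(d\boldsymbol u)=c_J$ for all $J\in\mathcal J$. Assume that $\{1\},\dots,\{d\}\in\mathcal J$ with $c_{\{j\}}=1$ for $j=1,\dots,d$, and that $$1=\sum_{j=1}^d u_j<\sum_{J\in\mathcal J}\max_{j\in J}u_j\quad\text{for all }\boldsymbol u\in\mathbb S_+ .$$ Then there exist (primal) linear semi-infinite programs $(\mathcal L_\rho')$ and $(\mathcal U_\rho')$ whose dual problems are $(\mathcal L_\rho)$ and $(\mathcal U_\rho)$, respectively. Furthermore, for $(\mathcal L_\rho')$ and $(\mathcal U_\rho')$: (i) the index set $T$ is a compact subset of $\mathbb R^d$ and the coefficient functions $\boldsymbol a$ and $b$ are continuous (hence bounded) on $T$; (ii) Slater's condition holds; (iii) the optimal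 values are finite; (iv) strong duality holds for the pairs $(\mathcal L_\rho,\mathcal L_\rho')$ and $(\mathcal U_\rho,\mathcal U_\rho')$; (v) the problems are reducible; (vi) there exist solutions to $(\mathcal L_\rho)$ and $(\mathcal U_\rho)$ that are supported on at most $|\mathcal J|$ atoms.
   Context: $\mathbb S_+=\{\boldsymbol u\in[0,\infty)^d:\sum_{i=1}^du_i=1\}$; all measures are non-negative. A linear semi-infinite program (LSIP) is a problem of the form $$(P)\quad\inf_{\boldsymbol x\in\mathbb R^p}\boldsymbol c^\top\boldsymbol x\quad\text{subject to } b(t)-\boldsymbol a(t)^\top\boldsymbol x\le0,\ t\in T,$$ where $T$ is a (possibly infinite) index set, $\boldsymbol a:T\to\mathbb R^p$, $b:T\to\mathbb R$ and $\boldsymbol c\in\mathbb R^p$. When $T\subset\mathbb R^d$ is compact and $\boldsymbol a,b$ are continuous, its dual is $$(D)\quad\sup_{\omega}\int_Tb(t)\,\omega(dt)\quad\text{subject to }\int_T\boldsymbol a(t)\,\omega(dt)=\boldsymbol c,$$ where $\omega$ ranges over the finite Borel measures on $T$. The minimization problem $(\mathcal L_\rho)$ is the dual of an LSIP involving maximization; formally, $\sup$ and $\inf$ are interchanged by changing the sign of the objective function. For an optimization problem, $\mathrm{val}(\cdot)$ denotes its optimal value and $\mathrm{sol}(\cdot)$ its solution set, i.e. the set of feasible points that yield the optimal value; $\mathrm{val}$ may be infinite and $\mathrm{sol}$ may be empty, and if $\mathrm{sol}(\cdot)=\varnothing$ then by convention $\mathrm{val}(\cdot)=\infty$ and the problem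 is called unsolvable. Slater's condition for $(P)$: there is $\tilde{\boldsymbol x}\in\mathbb R^p$ with $b(t)-\boldsymbol a(t)^\top\tilde{\boldsymbol x}<0$ for all $t\in T$. Strong duality for $(P,D)$: $\mathrm{val}(P)=\mathrm{val}(D)$ and $\mathrm{sol}(D)\ne\varnothing$. $(P)$ is reducible if there is a finite subset $T_m\subset T$ such that the linear program $(P_m)$ obtained from $(P)$ by keeping only the constraints with $t\in T_m$ satisfies $\mathrm{val}(P_m)=\mathrm{val}(P)$.
   Formalization: The optimal value val is taken as the plain infimum or supremum even when it is not attained, instead of being set to ∞ whenever sol is empty; under that literal convention (iii) and (iv) can fail, since the primal need not be attained. *)

(* Defs.v *)
From HB Require Import structures.
From mathcomp Require Import all_boot all_order all_algebra.
From mathcomp Require Import all_classical all_reals all_analysis.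

Set Implicit Arguments.
Unset Strict Implicit.
Unset Printing Implicit Defensive.

Import Order.TTheory GRing.Theory Num.Theory.
Import numFieldNormedType.Exports.

Local Open Scope classical_set_scope.
Local Open Scope ring_scope.

Inductive sense := Minimize | Maximize.

Record problem (R : realType) (X : Type) := Problem {
  direction : sense;
  feasible : set X;
  objective : X -> \bar R }.

(* The infimum (supremum) of the objective over the feasible set; it is
   +oo (-oo) when the feasible set is empty.  No attainment is required. *)
Definition value (R : realType) (X : Type) (Q : problem R X) : \bar R :=
  match direction Q with
  | Minimize => ereal_inf (objective Q @` feasible Q)
  | Maximize => ereal_sup (objective Q @` feasible Q)
  end.

Definition solutions (R : realType) (X : Type) (Q : problem R X) : set X :=
  [set x | feasible Q x /\ objective Q x = value Q].

(* Interchanges inf and sup by changing the sign of the objective. *)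
Definition negated (R : realType) (X : Type) (Q : problem R X) : problem R X :=
  Problem (match direction Q with
           | Minimize => Maximize
           | Maximize => Minimize
           end)
          (feasible Q) (fun x => (- objective Q x)%E).

Definition dotmul (R : realType) (p : nat) (x y : 'rV[R]_p) : R :=
  \sum_(i < p) x 0 i * y 0 i.

(* The functions coefA and coefb are total on the ambient type I, but only
   their values on the index set matter. *)
Record lsip (R : realType) (I : Type) (p : nat) := Lsip {
  index_set : set I;
  coefA : I -> 'rV[R]_p;
  coefb : I -> R;
  coefc : 'rV[R]_p }.

Definition primal (R : realType) (I : Type) (p : nat) (P : lsip R I p) :
    problem R 'rV[R]_p :=
  Problem Minimize
    [set x | forall t, index_set P t -> coefb P t - dotmul (coefA P t) x <= 0]
    (fun x => (dotmul (coefc P) x)%:E).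

Definition slater (R : realType) (I : Type) (p : nat) (P : lsip R I p) : Prop :=
  exists x : 'rV[R]_p,
    forall t, index_set P t -> coefb P t - dotmul (coefA P t) x < 0.

Definition restrict_index (R : realType) (I : Type) (p : nat)
    (P : lsip R I p) (T : set I) : lsip R I p :=
  Lsip T (coefA P) (coefb P) (coefc P).

Definition reducible (R : realType) (I : Type) (p : nat)
    (P : lsip R I p) : Prop :=
  exists Tm : set I, [/\ Tm `<=` index_set P, finite_set Tm &
    value (primal (restrict_index P Tm)) = value (primal P)].

Definition strong_duality (R : realType) (X Y : Type)
    (P : problem R X) (D : problem R Y) : Prop :=
  value P = value D /\ solutions D !=set0.

(* R^d with its Borel sigma-algebra. *)
Definition borel_rV (R : realType) (d : nat) :=
  g_sigma_algebraType (@open 'rV[R]_d).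

(* A finite Borel measure on a Borel set T of R^d is encoded as a finite Borel
   measure on R^d that vanishes outside T. *)
Definition carried_by (R : realType) (d : nat)
    (mu : {finite_measure set (borel_rV R d) -> \bar R}) (T : set 'rV[R]_d) :
    Prop :=
  mu (~` T) = 0%E.

(* Meaningful when the index set is compact (hence Borel) and the coefficient
   functions are continuous on it. *)
Definition dual (R : realType) (d p : nat) (P : lsip R 'rV[R]_d p) :
    problem R {finite_measure set (borel_rV R d) -> \bar R} :=
  Problem Maximize
    [set mu | carried_by mu (index_set P) /\
       forall i : 'I_p,
         (\int[mu]_(t in index_set P) (coefA P t 0 i)%:E = (coefc P 0 i)%:E)%E]
    (fun mu => (\int[mu]_(t in index_set P) (coefb P t)%:E)%E).

Definition supported_on_atoms (R : realType) (d : nat)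
    (mu : {finite_measure set (borel_rV R d) -> \bar R}) (n : nat) : Prop :=
  exists A : set 'rV[R]_d, (A #<= `I_n)%card /\ carried_by mu A.

Definition simplex (R : realType) (d : nat) : set 'rV[R]_d :=
  [set u | (forall i, 0 <= u 0 i) /\ \sum_(i < d) u 0 i = 1].

(* The default value 0 is harmless: this is the maximum of the u_j, j in J,
   for u with non-negative coordinates and J non-empty. *)
Definition maxcoord (R : realType) (d : nat) (J : {set 'I_d})
    (u : 'rV[R]_d) : R :=
  \big[Num.max/0]_(j in J) u 0 j.

Definition extremal_integral (R : realType) (d : nat)
    (H : {finite_measure set (borel_rV R d) -> \bar R}) (J : {set 'I_d}) :
    \bar R :=
  (\int[H]_(u in @simplex R d) (maxcoord J u)%:E)%E.

Definition rho (R : realType) (d : nat) (w : 'I_d -> R) (xi : R)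
    (H : {finite_measure set (borel_rV R d) -> \bar R}) : \bar R :=
  (\int[H]_(u in @simplex R d)
     ((\sum_(i < d) w i * (u : 'rV[R]_d) 0 i `^ xi) `^ (1 / xi))%:E)%E.

Definition moment_class (R : realType) (d : nat) (JJ : {set {set 'I_d}})
    (c : {set 'I_d} -> R) :
    set {finite_measure set (borel_rV R d) -> \bar R} :=
  [set H | carried_by H (@simplex R d) /\
     forall J, J \in JJ -> extremal_integral H J = (c J)%:E].

Definition rho_problem (R : realType) (d : nat) (s : sense) (w : 'I_d -> R)
    (xi : R) (JJ : {set {set 'I_d}}) (c : {set 'I_d} -> R) :
    problem R {finite_measure set (borel_rV R d) -> \bar R} :=
  Problem s (moment_class JJ c) (rho w xi).

Definition lower_problem (R : realType) (d : nat) :=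
  @rho_problem R d Minimize.

Definition upper_problem (R : realType) (d : nat) :=
  @rho_problem R d Maximize.

(* Main.v *)
(* The functions a_J(u) = max_{j in J} u_j satisfy sum_J a_J >= 1 on the simplex,
   so conic combinations of the vectors a(u) with a bounded value have bounded
   mass. As the simplex is compact, the nearest-point projection onto the cones
   generated by a(u) or by (a(u), b(u)) therefore exists, which gives Farkas'
   lemma. Farkas' lemma and weak duality put the point (c, val P) in the cone
   generated by the points (a(u), b(u)). Carathéodory elimination along
   dependencies of the a(u) alone, oriented so that the objective does not
   decrease, then leaves |J| atoms: they form a discrete dual solution, and the
   constraints at these atoms already determine the value of the primal. *)

Require Import Defs.
From HB Require Import structures.
From mathcomp Require Import all_boot all_order all_algebra.
From mathcomp Require Import all_classical all_reals all_analysis.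
From mathcomp Require Import measurable_realfun.
From mathcomp Require Import ring lra.

Set Implicit Arguments.
Unset Strict Implicit.
Unset Printing Implicit Defensive.

Import Order.TTheory GRing.Theory Num.Theory.
Import numFieldNormedType.Exports.

Local Open Scope classical_set_scope.
Local Open Scope ring_scope.

(** * Dot product algebra *)

Lemma dotmulC (R : realType) p (x y : 'rV[R]_p) : dotmul x y = dotmul y x.
Proof. by apply: eq_bigr => i _; rewrite mulrC. Qed.

Lemma dotmulDl (R : realType) p (x y z : 'rV[R]_p) :
  dotmul (x + y) z = dotmul x z + dotmul y z.
Proof. by rewrite -big_split; apply: eq_bigr => i _; rewrite mxE mulrDl. Qed.

Lemma dotmulZl (R : realType) p (k : R) (x z : 'rV[R]_p) :
  dotmul (k *: x) z = k * dotmul x z.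
Proof. by rewrite mulr_sumr; apply: eq_bigr => i _; rewrite mxE mulrA. Qed.

Lemma dotmul0l (R : realType) p (z : 'rV[R]_p) : dotmul 0 z = 0.
Proof. by apply: big1 => i _; rewrite mxE mul0r. Qed.

Lemma dotmulDr (R : realType) p (x y z : 'rV[R]_p) :
  dotmul z (x + y) = dotmul z x + dotmul z y.
Proof. by rewrite dotmulC dotmulDl !(dotmulC z). Qed.

Lemma dotmulZr (R : realType) p (k : R) (x z : 'rV[R]_p) :
  dotmul z (k *: x) = k * dotmul z x.
Proof. by rewrite dotmulC dotmulZl dotmulC. Qed.

Lemma dotmul_suml (R : realType) p n (l : 'I_n -> R) (v : 'I_n -> 'rV[R]_p) z :
  dotmul (\sum_i l i *: v i) z = \sum_i l i * dotmul (v i) z.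
Proof.
elim/big_ind2 : _ => [|x1 x2 y1 y2 <- <-|i _]; first exact: dotmul0l.
- exact: dotmulDl.
- exact: dotmulZl.
Qed.

Lemma dotmul_ge0 (R : realType) p (x : 'rV[R]_p) : 0 <= dotmul x x.
Proof. by apply: sumr_ge0 => i _; rewrite -expr2 sqr_ge0. Qed.

Lemma dotmul_eq0 (R : realType) p (x : 'rV[R]_p) : dotmul x x <= 0 -> x = 0.
Proof.
move=> x0; have /eqP : dotmul x x = 0 by apply/eqP; rewrite eq_le x0 dotmul_ge0.
rewrite psumr_eq0 => [/allP h|i _]; last by rewrite -expr2 sqr_ge0.
apply/rowP => i; have := h i (mem_index_enum i).
by rewrite /= -expr2 sqrf_eq0 mxE => /eqP.
Qed.

Lemma dotmul_sqrD (R : realType) p (x y : 'rV[R]_p) :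
  dotmul (x + y) (x + y) = dotmul x x + 2 * dotmul x y + dotmul y y.
Proof. by rewrite dotmulDl !dotmulDr (dotmulC y x); ring. Qed.

(** * Conic combinations and Farkas' lemma *)

(* Carathéodory's elimination step, along a linear dependency oriented so that
   the secondary functional g does not decrease. *)
Lemma conic_drop (R : realType) (X : Type) (T : set X) m (v : X -> 'rV[R]_m)
    (g : X -> R) (e : 'rV[R]_m) (he : forall t, T t -> 0 < dotmul (v t) e)
    n (mn : (m <= n)%N) (l : 'I_n.+1 -> R) (t : 'I_n.+1 -> X) :
  (forall i, 0 <= l i) -> (forall i, T (t i)) ->
  exists (l' : 'I_n -> R) (t' : 'I_n -> X),
    [/\ forall i, 0 <= l' i, forall i, T (t' i),
       \sum_i l' i *: v (t' i) = \sum_i l i *: v (t i) &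
       \sum_i l i * g (t i) <= \sum_i l' i * g (t' i)].
Proof.
move=> l0 Tt; pose A := \matrix_(i < n.+1) v (t i).
have [mu [mu0 muv mug]] : exists mu : 'I_n.+1 -> R,
    [/\ exists i, mu i != 0, \sum_i mu i *: v (t i) = 0 &
        0 <= \sum_i mu i * g (t i)].
  (* The [n.+1] rows of [A] lie in dimension [m <= n], so they are linearly dependent. *)
  have : kermx A != 0.
    rewrite kermx_eq0 /row_free; apply/eqP => rA.
    by have := rank_leq_col A; rewrite rA leqNgt ltnS mn.
  move=> /rowV0Pn[u /sub_kermxP uA u0].
  have uv : \sum_i u 0 i *: v (t i) = 0.
    rewrite -[RHS]uA mulmx_sum_row; apply: eq_bigr => i _; rewrite rowK.
    by congr (_ *: _); congr (u _ _); apply: val_inj.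
  have [i ui] : exists i, u 0 i != 0.
    apply: contra_neqP u0 => /forallNP u0; apply/rowP => i.
    by rewrite mxE; apply/eqP/negPn/negP/u0.
  have [h|h] := leP 0 (\sum_i u 0 i * g (t i)).
    by exists (u 0); split => //; exists i.
  exists (fun i => - u 0 i); split; first by exists i; rewrite oppr_eq0.
    under eq_bigr do rewrite scaleNr.
    by rewrite sumrN uv oppr0.
  under eq_bigr do rewrite mulNr.
  by rewrite sumrN oppr_ge0 ltW.
(* A non-negative dependency, paired with [e], would be a vanishing sum of non-negative terms with
   one of them positive. *)
have [i0 mui0] : exists i, mu i < 0.
  apply: contrapT => /forallNP nmu; case: mu0 => i /negP; apply.
  have mup j : 0 <= mu j by rewrite leNgt; apply/negP/nmu.
  have := dotmul_suml mu (fun i => v (t i)) e.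
  rewrite muv dotmul0l => /esym/eqP; rewrite psumr_eq0; last first.
    by move=> j _; rewrite mulr_ge0// ltW// he.
  move=> /allP/(_ i (mem_index_enum i)) /=.
  by rewrite mulf_eq0 (gt_eqF (he _ (Tt i))) orbF.
(* Ratio test: [th] is the largest step along [mu] that keeps every coefficient non-negative, and it
   makes the coefficient of index [i] vanish. *)
have [i mui imin] := @arg_minP _ _ _ _ (fun i => mu i < 0)
  (fun i => l i / - mu i) mui0.
pose th := l i / - mu i.
have th0 : 0 <= th by rewrite divr_ge0// oppr_ge0 ltW.
pose k j := l j + th * mu j.
have ki : k i = 0 by rewrite /k /th; field; rewrite lt_eqF.
have k0 j : 0 <= k j.
  rewrite /k; have [muj|muj] := leP 0 (mu j).
    by rewrite addr_ge0// mulr_ge0.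
  by have := imin _ muj; rewrite ler_pdivlMr ?oppr_gt0// -/th; lra.
exists (k \o lift i), (t \o lift i); split => [j|j||] /=.
- exact: k0.
- exact: Tt.
- transitivity (\sum_j k j *: v (t j)).
    by rewrite [RHS](bigD1_ord i)//= ki scale0r add0r.
  under [LHS]eq_bigr do rewrite /k scalerDl -scalerA.
  by rewrite big_split/= -scaler_sumr muv scaler0 addr0.
- apply: (@le_trans _ _ (\sum_j k j * g (t j))).
    under [leRHS]eq_bigr do rewrite /k mulrDl -mulrA.
    by rewrite big_split/= -mulr_sumr lerDl mulr_ge0.
  by rewrite (bigD1_ord i)//= ki mul0r add0r.
Qed.

(** First-order condition at a minimum: a negative slope [a] would outweigh the quadratic term for
    small [s]. *)
Lemma slope_ge0 (R : realType) (a b : R) :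
  (forall s, 0 < s <= 1 -> 0 <= s * a + s ^+ 2 * b) -> 0 <= a.
Proof.
move=> h; rewrite leNgt; apply/negP => a0.
(* [D] dominates both [b] and [- a], so [s = - a / (2 * D)] is at most 1 and
   [a + s * b <= a / 2 < 0]. *)
pose D := `|b| - a; have D0 : 0 < D by rewrite /D; have := normr_ge0 b; lra.
pose s := - a / (2 * D).
have s0 : 0 < s by rewrite divr_gt0 ?oppr_gt0// mulr_gt0.
have sD : s * (2 * D) = - a by rewrite /s mulfVK// gt_eqF// mulr_gt0.
have s1 : s <= 1.
  by rewrite /s ler_pdivrMr ?mulr_gt0// mul1r /D; have := normr_ge0 b; lra.
have := h s; rewrite s0 s1 => /(_ isT); apply/negP; rewrite -ltNge.
have -> : s * a + s ^+ 2 * b = s * (a + s * b) by ring.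
rewrite pmulr_rlt0//.
have : s * b <= s * D.
  by rewrite ler_pM2l// /D; have := ler_norm b; lra.
by lra.
Qed.

Lemma continuous_sum (R : realType) (V : normedModType R) (I : finType)
    (X : topologicalType) (P : pred I) (F : I -> X -> V) :
  (forall i, P i -> continuous (F i)) ->
  continuous (fun x => \sum_(i | P i) F i x).
Proof. by move=> cF; apply: continuous_big => //; exact: add_continuous. Qed.

Lemma continuous_coord (R : realType) (X : topologicalType) n
    (f : X -> 'rV[R]_n) i : continuous f -> continuous (fun t => f t 0 i).
Proof.
move=> cf t.
apply: (@continuous_comp _ _ _ f (fun x : 'rV_n => x 0 i)); first exact: cf.
exact: coord_continuous.
Qed.

Section farkas.
Context (R : realType) (X : topologicalType) (T : set X) (m : nat).
Context (v : X -> 'rV[R]_m) (e z : 'rV[R]_m).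
Hypotheses (cT : compact T) (T0 : T !=set0) (cv : continuous v).
Hypothesis he : forall t, T t -> 1 <= dotmul (v t) e.

(** A point of [E] is a list of [m] weighted generators. Tychonoff's theorem applies to this
    product. *)
Let E := prod_topology (fun _ : 'I_m => (R * X)%type).
Let dev (f : E) := \sum_i (f i).1 *: v (f i).2 - z.

Let dev_continuous : continuous (fun f => dotmul (dev f) (dev f)).
Proof.
have ci j f' : {for f', continuous (fun f : E => (f j).1 *: v (f j).2)}.
  have pj : continuous (fun f : E => f j) := @proj_continuous _ _ j.
  apply: continuousZ.
  + by apply: continuous_comp; [exact: pj|exact: cvg_fst].
  + apply: (@continuous_comp _ _ _ (fun f : E => (f j).2) v); last exact: cv.
    by apply: continuous_comp; [exact: pj|exact: cvg_snd].
have csum : continuous (fun f : E => \sum_i (f i).1 *: v (f i).2).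
  by apply: continuous_sum => j _ f; exact: ci.
have cdev i : continuous (fun f => dev f 0 i).
  apply: continuous_coord => f.
  apply: (@continuousB R 'rV_m E (fun f => \sum_i (f i).1 *: v (f i).2) (cst z)).
    exact: csum.
  exact: cst_continuous.
by apply: continuous_sum => i _ f; apply: continuousM; exact: cdev.
Qed.

(** Bounding the weights by some [M] makes the search space compact. Combinations with a weight
    above [M] are farther from [z] than the apex 0 of the cone. *)
Lemma conic_nearest : exists (l : 'I_m -> R) (t : 'I_m -> X),
  [/\ forall i, 0 <= l i, forall i, T (t i) &
    forall (l' : 'I_m -> R) (t' : 'I_m -> X),
      (forall i, 0 <= l' i) -> (forall i, T (t' i)) ->
      let y := \sum_i l i *: v (t i) - z in
      let y' := \sum_i l' i *: v (t' i) - z in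
      dotmul y y <= dotmul y' y'].
Proof.
have [t0 Tt0] := T0.
(* With [y'] the deviation from [z], a weight is at most [dotmul z e + dotmul y' e], and
   [dotmul y' e] is at most half of [dotmul y' y' + dotmul e e]. So a weight above [M] forces
   [dotmul y' y' > dotmul z z]. The absolute value keeps 0 in the segment. *)
pose M := `|dotmul z e + (dotmul z z + dotmul e e) / 2|.
pose S : set E := [set f | forall i, (`[0, M] `*` T) (f i)].
have cS : compact S.
  apply: (@tychonoff _ (fun=> (R * X)%type) (fun=> `[0, M] `*` T)) => i.
  by apply: compact_setX => //; exact: segment_compact.
pose f0 : E := fun=> (0, t0).
have Sf0 : S f0 by move=> i; split => //=; rewrite in_itv/= lexx normr_ge0.
have dev0 : dev f0 = - z.
  by rewrite /dev big1 ?add0r// => i _; rewrite scale0r.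
have [f /set_mem Sf fmin] := compact_EVT_min (ex_intro _ _ Sf0) cS
  (continuous_subspaceT dev_continuous).
exists (fun i => (f i).1), (fun i => (f i).2); split => [i|i|l t l0 Tt /=].
- by have [/=] := Sf i; rewrite in_itv/= => /andP[].
- by have [] := Sf i.
pose y := dev f; pose y' := \sum_i l i *: v (t i) - z.
rewrite -/(dev f) -/y -/y'.
have [lM|] := pselect (forall i, l i <= M).
  apply: (fmin (fun i => (l i, t i)) _); apply/mem_set => i; split => //=.
  by rewrite in_itv/= l0 lM.
move=> /existsNP[i /negP]; rewrite -ltNge => Ml.
have yz : dotmul y y <= dotmul z z.
  have := fmin f0 (mem_set Sf0); rewrite dev0.
  by rewrite -scaleN1r dotmulZl dotmulZr !mulN1r opprK.
have le_sum : l i <= dotmul (\sum_i l i *: v (t i)) e.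
  rewrite dotmul_suml (bigD1 i)//=.
  have h1 := he (Tt i).
  apply: le_trans (_ : l i * dotmul (v (t i)) e <= _); first by rewrite ler_peMr.
  rewrite lerDl sumr_ge0// => j _; rewrite mulr_ge0//.
  exact: le_trans ler01 (he (Tt j)).
have : dotmul (\sum_i l i *: v (t i)) e = dotmul z e + dotmul y' e.
  by rewrite -dotmulDl /y' addrC subrK.
have := dotmul_ge0 (y' - e); rewrite -scaleN1r dotmul_sqrD !(dotmulZl, dotmulZr).
have := ler_norm (dotmul z e + (dotmul z z + dotmul e e) / 2); rewrite -/M.
by lra.
Qed.

(** Let [k] be a nearest point of the cone and [y = k - z]. Minimality makes [y] non-negative on all
    generators and [dotmul k y <= 0]. The hypothesis then gives [dotmul z y >= 0], so
    [dotmul y y <= 0]. *)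
Lemma farkas :
  (forall y, (forall t, T t -> 0 <= dotmul (v t) y) -> 0 <= dotmul z y) ->
  exists (l : 'I_m -> R) (t : 'I_m -> X),
    [/\ forall i, 0 <= l i, forall i, T (t i) & \sum_i l i *: v (t i) = z].
Proof.
move=> hz; have [l [t [l0 Tt lmin]]] := conic_nearest.
exists l, t; split => //.
set k := \sum_i _ *: _; pose y := k - z.
suff /eqP : y = 0 by rewrite subr_eq0 => /eqP.
have he' s : T s -> 0 < dotmul (v s) e by move/he; exact: lt_le_trans.
apply: dotmul_eq0.
have yv s : T s -> 0 <= dotmul (v s) y.
  move=> Ts; suff : 0 <= 2 * dotmul (v s) y by rewrite pmulr_rge0.
  apply: (@slope_ge0 _ _ (dotmul (v s) (v s))) => r /andP[r0 _].
  (* Moving from [k] along [v s] uses [m.+1] generators. [conic_drop] brings them back to [m], so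
     that minimality applies. *)
  pose l1 i := if unlift ord0 i is Some j then l j else r.
  pose t1 i := if unlift ord0 i is Some j then t j else s.
  have [||l' [t' [l'0 Tt' E' _]]] :=
      conic_drop (fun=> 0) he' (leqnn m) (l := l1) (t := t1).
  - by move=> i; rewrite /l1; case: unlift => // *; rewrite ltW.
  - by move=> i; rewrite /t1; case: unlift.
  have Ek : \sum_i l1 i *: v (t1 i) = r *: v s + k.
    rewrite big_ord_recl /l1 /t1 unlift_none; congr (_ + _).
    by apply: eq_bigr => i _; rewrite liftK.
  have Ey : r *: v s + k - z = y + r *: v s by rewrite -addrA addrC.
  have := lmin _ _ l'0 Tt'; rewrite E' Ek /= Ey -/k -/y.
  by rewrite (dotmul_sqrD y) !(dotmulZl, dotmulZr) (dotmulC y) => h; lra.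
(* Shrinking [k] towards the apex by a factor [1 - r] stays in the cone because [r <= 1]. *)
have yk : 0 <= - dotmul k y.
  suff : 0 <= 2 * - dotmul k y by rewrite pmulr_rge0.
  apply: (@slope_ge0 _ _ (dotmul k k)) => r /andP[r0 r1].
  have Ek : \sum_i ((1 - r) * l i) *: v (t i) = (1 - r) *: k.
    by rewrite scaler_sumr; apply: eq_bigr => i _; rewrite scalerA.
  have Ey : (1 - r) *: k - z = y + (- r) *: k.
    by rewrite scalerBl scale1r scaleNr addrAC.
  have l1 i : 0 <= (1 - r) * l i by rewrite mulr_ge0// subr_ge0.
  have := lmin _ _ l1 Tt; rewrite /= Ek Ey -/k -/y.
  by rewrite (dotmul_sqrD y) !(dotmulZl, dotmulZr) (dotmulC y k) => h; lra.
have -> : dotmul y y = dotmul k y - dotmul z y.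
  by rewrite [LHS]dotmulDl -scaleN1r dotmulZl mulN1r.
by have := hz y yv; lra.
Qed.

End farkas.

(** * Borel measurability, integrability and discrete measures *)

Lemma continuous_borel_measurable (R : realType) d (f : 'rV[R]_d -> R) :
  continuous f -> measurable_fun [set: borel_rV R d] f.
Proof.
move=> /continuousP cf; apply: (measurability _ (RGenOpens.measurableE R)).
move=> _ [_ [a [b ->] <-]]; rewrite setTI.
by apply: sub_sigma_algebra; exact/cf/interval_open.
Qed.

Lemma compact_borel_measurable (R : realType) d (T : set 'rV[R]_d) :
  compact T -> measurable (T : set (borel_rV R d)).
Proof.
move=> /(compact_closed (@norm_hausdorff _ _)) cT.
rewrite -[T]setCK; apply: measurableC.
by apply: sub_sigma_algebra; exact: closed_openC.
Qed.

Lemma continuous_compact_bounded (R : realType) d (V : normedModType R)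
    (T : set 'rV[R]_d) (f : 'rV[R]_d -> V) :
  compact T -> continuous f -> [bounded f t | t in T].
Proof.
move=> cT cf; have /compact_bounded[M [Mr fM]] :=
  continuous_compact (continuous_subspaceT cf) cT.
by exists M; split => // x Mx t Tt; apply: fM => //; exists t.
Qed.

Lemma continuous_compact_borel_integrable (R : realType) d
    (mu : {finite_measure set (borel_rV R d) -> \bar R})
    (T : set 'rV[R]_d) (f : 'rV[R]_d -> R) :
  compact T -> continuous f ->
  mu.-integrable (T : set (borel_rV R d)) (fun t => (f t)%:E).
Proof.
move=> cT cf; have mT := compact_borel_measurable cT.
apply: measurable_bounded_integrable => //.
- by rewrite ltey_eq fin_num_measure.
- by apply: measurable_funTS; exact: continuous_borel_measurable.
- exact: continuous_compact_bounded.
Qed.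

(** The measure is a weighted sum of Dirac masses. The integral formula is first shown for
    non-negative functions, then extended through positive and negative parts. *)
Lemma atomic_measure disp (T : measurableType disp) (R : realType) n
    (l : 'I_n -> R) (t : 'I_n -> T) : (forall i, 0 <= l i) ->
  exists mu : {finite_measure set T -> \bar R},
    (forall A, (forall i, ~ A (t i)) -> mu A = 0%E) /\
    (forall (D : set T) (f : T -> R), measurable D -> measurable_fun D f ->
       (forall i, D (t i)) ->
       \int[mu]_(x in D) (f x)%:E = (\sum_i l i * f (t i))%:E)%E.
Proof.
move=> l0.
(* [msum] takes a sequence indexed by [nat]. The zero measure fills the indices from [n] on. *)
pose m (k : nat) : {measure set T -> \bar R} :=
  if insub k is Some i then mscale (NngNum (l0 i)) (dirac (t i)) else mzero.
have mE (i : 'I_n) :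
    m i = mscale (NngNum (l0 i)) (dirac (t i)) :> {measure set T -> \bar R}.
  rewrite /m insubT//= => i'.
  by congr (mscale (NngNum (l0 _)) (dirac (t _))); exact: val_inj.
pose nu := msum m n.
have nuE A : nu A = (\sum_(i < n) (l i)%:E * \d_(t i) A)%E.
  by apply: eq_bigr => i _; rewrite mE.
have nufin : fin_num_fun nu.
  move=> A mA; rewrite nuE; under eq_bigr do rewrite diracE -EFinM.
  by rewrite sumEFin.
pose mf := Measure_isFinite.Build _ T R nu nufin.
have [mu muE] : exists mu : {finite_measure set T -> \bar R},
    mu = nu :> (set T -> \bar R).
  by exists (HB.pack nu mf : {finite_measure set T -> \bar R}).
exists mu; split => [A tA|D f mD mfD tD].
  rewrite muE nuE big1// => i _.
  by rewrite diracE memNset ?mule0//; exact: tA.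
have ge0 (g : T -> R) : measurable_fun D g -> (forall x, 0 <= g x) ->
    (\int[mu]_(x in D) (g x)%:E = (\sum_i l i * g (t i))%:E)%E.
  move=> mg g0.
  have Eg0 x : D x -> (0 <= (EFin \o g) x)%E by rewrite lee_fin.
  have mEg : measurable_fun D (EFin \o g) by exact/measurable_EFinP.
  rewrite (@eq_measure_integral _ _ _ _ nu) => [|A _ _]; last first.
    exact: (congr1 (@^~ A) muE).
  rewrite (ge0_integral_measure_sum m mD _ mEg)//.
  rewrite -sumEFin; apply: eq_bigr => i _.
  rewrite mE ge0_integral_mscale// (integral_dirac _ mD mEg) diracE mem_set//.
  by rewrite mul1e EFinM.
rewrite integralE.
have -> : ((fun x => (f x)%:E)^\+ = fun x => (Num.max (f x) 0)%:E)%E.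
  by apply/funext => x; rewrite funeposE EFin_max.
have -> : ((fun x => (f x)%:E)^\- = fun x => (Num.max (- f x) 0)%:E)%E.
  by apply/funext => x; rewrite funenegE EFin_max.
rewrite !ge0; last first.
- by move=> x; rewrite le_max lexx orbT.
- exact: measurable_maxr.
- by move=> x; rewrite le_max lexx orbT.
- by apply: measurable_maxr => //; exact: measurableT_comp.
rewrite -EFinB; congr EFin; rewrite -sumrB; apply: eq_bigr => i _.
rewrite -mulrBr; congr (_ * _).
by have [h|h] := leP (f (t i)) 0; have [h'|h'] := leP (- f (t i)) 0; lra.
Qed.

(** * Weak duality *)

Section duality.
Context (R : realType) (d p : nat) (P : lsip R 'rV[R]_d p).
Hypotheses (cT : compact (index_set P)) (cA : continuous (coefA P))
  (cb : continuous (coefb P)).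

Let T := index_set P.
Let M := {finite_measure set (borel_rV R d) -> \bar R}.

Lemma integral_dotmul (mu : M) x : feasible (dual P) mu ->
  (\int[mu]_(t in T) (dotmul (coefA P t) x)%:E = (dotmul (coefc P) x)%:E)%E.
Proof.
move=> [_ muA]; have mT := compact_borel_measurable cT.
have ci (i : 'I_p) : continuous (fun t => coefA P t 0 i).
  exact: continuous_coord.
transitivity (\int[mu]_(t in T) \sum_(i < p) ((x 0 i)%:E * (coefA P t 0 i)%:E))%E.
  apply: eq_integral => t _; rewrite -sumEFin; apply: eq_bigr => i _.
  by rewrite -EFinM mulrC.
rewrite integral_sum//; last first.
  move=> i; apply: integrableZl => //.
  exact: continuous_compact_borel_integrable.
rewrite -sumEFin; apply: eq_bigr => i _.
rewrite integralZl//; last exact: continuous_compact_borel_integrable.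
by rewrite muA -EFinM mulrC.
Qed.

(** Integrate the pointwise inequality against [mu]. The case [s = -1] is weak duality. The
    separating functionals from Farkas' lemma call for other values of [s]. *)
Lemma weak_duality_comb (mu : M) x s : feasible (dual P) mu ->
  (forall t, T t -> 0 <= dotmul (coefA P t) x + s * coefb P t) ->
  (0 <= (dotmul (coefc P) x)%:E + s%:E * objective (dual P) mu)%E.
Proof.
move=> fmu h; have mT := compact_borel_measurable cT.
have cAx : continuous (fun t => dotmul (coefA P t) x).
  apply: continuous_sum => i _ t; apply: continuousM; last exact: cst_continuous.
  exact: continuous_coord.
rewrite -(integral_dotmul x fmu) /= -integralZl//; last first.
  exact: continuous_compact_borel_integrable.
rewrite -integralD//; last 2 first.
- exact: continuous_compact_borel_integrable.
- by apply: integrableZl => //; exact: continuous_compact_borel_integrable.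
by apply: integral_ge0 => t Tt; rewrite -EFinM -EFinD lee_fin; exact: h.
Qed.

Lemma weak_duality (mu : M) x : feasible (dual P) mu -> feasible (primal P) x ->
  (objective (dual P) mu <= objective (primal P) x)%E.
Proof.
move=> fmu fx.
have := @weak_duality_comb mu x (-1) fmu.
rewrite EFinN mulN1e sube_ge0 ?fin_numE ?orbT//.
by apply => t Tt; rewrite mulN1r; have := fx t Tt; lra.
Qed.

End duality.

(** * Strong duality and reducibility *)

Lemma continuous_row (R : realType) (X : topologicalType) n
    (f : X -> 'rV[R]_n) :
  (forall i, continuous (fun t => f t 0 i)) -> continuous f.
Proof.
move=> cf; rewrite (_ : f = fun t => \sum_i f t 0 i *: delta_mx 0 i); last first.
  by apply/funext => t; exact: row_sum_delta.
apply: continuous_sum => i _ t.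
by apply: continuousZ; [exact: cf|exact: cst_continuous].
Qed.

Lemma dotmul_row_mx (R : realType) m n (x y : 'rV[R]_m) (u v : 'rV[R]_n) :
  dotmul (row_mx x u) (row_mx y v) = dotmul x y + dotmul u v.
Proof.
rewrite /dotmul big_split_ord.
by congr (_ + _); apply: eq_bigr => i _; rewrite ?(row_mxEl, row_mxEr).
Qed.

Section strong_duality.
Context (R : realType) (d p : nat) (P : lsip R 'rV[R]_d p).
Context (e : 'rV[R]_p) (mu0 : {finite_measure set (borel_rV R d) -> \bar R}).
Hypotheses (cT : compact (index_set P)) (T0 : index_set P !=set0).
Hypotheses (cA : continuous (coefA P)) (cb : continuous (coefb P)).
Hypothesis he : forall t, index_set P t -> 1 <= dotmul (coefA P t) e.
Hypothesis fmu0 : feasible (dual P) mu0.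

Let T := index_set P.

(** A multiple of [e] that exceeds a bound of [coefb P] is strictly feasible, since [e] pairs to at
    least 1 with every [coefA P t]. *)
Lemma lsip_slater : slater P.
Proof.
have [M [_ bM]] := continuous_compact_bounded cT cb.
pose K := `|M| + 1.
have MK : M < K by rewrite /K; have := ler_norm M; lra.
exists ((K + 1) *: e) => t Tt; rewrite dotmulZr.
have bK : coefb P t <= K by apply: le_trans (ler_norm _) (bM _ MK t Tt).
have K0 : 0 <= K + 1 by rewrite /K; have := normr_ge0 M; lra.
have : K + 1 <= (K + 1) * dotmul (coefA P t) e by rewrite ler_peMr// he.
lra.
Qed.

(** The Slater point bounds the value from above, and the dual feasible [mu0] bounds it from
    below. *)
Lemma lsip_value_fin_num : value (primal P) \is a fin_num.
Proof.
have [x0 sx0] := lsip_slater.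
have fx0 : feasible (primal P) x0 by move=> t Tt; rewrite ltW// sx0.
rewrite fin_numElt; apply/andP; split.
- apply: (@lt_le_trans _ _ (objective (dual P) mu0)).
    rewrite ltNye_eq; apply/orP; left; apply: integrable_fin_num.
      exact: compact_borel_measurable.
    exact: continuous_compact_borel_integrable.
  by apply/ereal_infP => _ [x fx <-]; exact: weak_duality.
- apply: (@le_lt_trans _ _ (dotmul (coefc P) x0)%:E); last exact: ltry.
  by apply: ereal_inf_lbound; exists x0.
Qed.

Let beta := fine (value (primal P)).

Let betaE : beta%:E = value (primal P).
Proof. by rewrite fineK// lsip_value_fin_num. Qed.

Lemma beta_le x : feasible (primal P) x -> beta <= dotmul (coefc P) x.
Proof.
by move=> fx; rewrite -lee_fin betaE; apply: ereal_inf_lbound; exists x.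
Qed.

(* By Farkas' lemma the point (c, val P) belongs to the cone generated by the
   points (a t, b t): a separating functional (x, s) with s < 0 would rescale
   to a feasible x that beats the value of P, and one with s >= 0 would
   contradict weak duality. *)
Lemma lsip_value_conic :
  exists (l : 'I_(p + 1) -> R) (t : 'I_(p + 1) -> 'rV[R]_d),
    [/\ forall i, 0 <= l i, forall i, T (t i),
       \sum_i l i *: coefA P (t i) = coefc P &
       \sum_i l i * coefb P (t i) = beta].
Proof.
pose v t : 'rV_(p + 1) := row_mx (coefA P t) (const_mx (coefb P t)).
pose z : 'rV_(p + 1) := row_mx (coefc P) (const_mx beta).
(* The last coordinate 0 cancels the contribution of [coefb P], so the normalization by [e] carries
   over. *)
pose e1 : 'rV_(p + 1) := row_mx e (const_mx 0).
have dc (r s : R) : dotmul (const_mx r : 'rV_1) (const_mx s) = r * s.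
  by rewrite /dotmul big_ord_recl big_ord0 addr0 !mxE.
have cv : continuous v.
  apply: continuous_row => i.
  rewrite (_ : (fun t => _) = fun t =>
      match fintype.split i with
      | inl j => coefA P t 0 j
      | inr _ => coefb P t
      end); last first.
    by apply/funext => t; rewrite mxE; case: fintype.split => // j; rewrite mxE.
  case: fintype.split => [j t|_ t]; last exact: cb.
  exact: continuous_coord.
have he1 t : T t -> 1 <= dotmul (v t) e1.
  by move=> Tt; rewrite dotmul_row_mx dc mulr0 addr0 he.
have [y hy|l [t [l0 Tt lz]]] := farkas (z := z) cT T0 cv he1.
  pose x := lsubmx y; pose s := y 0 (rshift p 0).
  have yE : y = row_mx x (const_mx s).
    rewrite -[LHS]hsubmxK; congr row_mx; apply/rowP => i.
    by rewrite (ord1 i) !mxE.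
  have {}hy t : T t -> 0 <= dotmul (coefA P t) x + s * coefb P t.
    by move=> Tt; have := hy t Tt; rewrite yE dotmul_row_mx dc mulrC.
  rewrite yE dotmul_row_mx dc mulrC.
  have [s0|s0] := leP 0 s.
    (* For [s >= 0], replacing the objective of [mu0] by the larger [beta] preserves the
       inequality. *)
    rewrite -lee_fin; apply: le_trans (weak_duality_comb cT cA cb fmu0 hy) _.
    rewrite EFinD EFinM leeD2l// lee_wpmul2l//.
    rewrite betaE; apply/ereal_infP => _ [x' fx' <-].
    exact: weak_duality.
  have Ns0 : 0 < - s by rewrite oppr_gt0.
  have : beta <= dotmul (coefc P) ((- s)^-1 *: x).
    apply: beta_le => t Tt; rewrite dotmulZr.
    rewrite subr_le0 mulrC ler_pdivlMr//.
    by have := hy t Tt; lra.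
  by rewrite dotmulZr ler_pdivlMl//; lra.
exists l, t; split => //.
  apply/rowP => i; have /rowP/(_ (lshift 1 i)) := lz.
  rewrite row_mxEl => <-; rewrite !summxE; apply: eq_bigr => j _.
  by rewrite mxE [RHS]mxE row_mxEl.
have /rowP/(_ (rshift p 0)) := lz.
rewrite row_mxEr [in RHS]mxE => <-; rewrite summxE; apply: eq_bigr => j _.
by rewrite [RHS]mxE row_mxEr mxE.
Qed.

(** One elimination step with secondary functional [coefb P] removes the extra atom. Equality with
    [beta] weakens to the inequality that weak duality complements. *)
Lemma lsip_optimal_atoms :
  exists (l : 'I_p -> R) (t : 'I_p -> 'rV[R]_d),
    [/\ forall i, 0 <= l i, forall i, T (t i),
       \sum_i l i *: coefA P (t i) = coefc P &
       beta <= \sum_i l i * coefb P (t i)].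
Proof.
have [l [t [l0 Tt lc lb]]] := lsip_value_conic.
have p1 : (p + 1 = p.+1)%N by rewrite addn1.
move: l t l0 Tt lc lb; rewrite p1 => l t l0 Tt lc lb.
have he' s : T s -> 0 < dotmul (coefA P s) e by move/he; exact: lt_le_trans.
have [l' [t' [? ? E1 E2]]] := conic_drop (coefb P) he' (leqnn p) l0 Tt.
by exists l', t'; split; rewrite // ?E1// -lb.
Qed.

(** The optimal atoms form a dual feasible measure whose objective is at least the primal value, so
    weak duality forces equality. *)
Theorem lsip_strong_duality :
  [/\ value (primal P) = value (dual P), reducible P &
    exists mu, solutions (dual P) mu /\ supported_on_atoms mu p].
Proof.
have [l [t [l0 Tt lc lb]]] := lsip_optimal_atoms.
have mT := compact_borel_measurable cT.
have [mu [muN muI]] := atomic_measure (t : 'I_p -> borel_rV R d) l0.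
have intC (f : 'rV[R]_d -> R) : continuous f ->
    (\int[mu]_(x in T) (f x)%:E = (\sum_i l i * f (t i))%:E)%E.
  move=> cf; apply: muI => //.
  by apply: measurable_funTS; exact: continuous_borel_measurable.
have fmu : feasible (dual P) mu.
  split => [|i]; first by apply: muN => i; apply; exact: Tt.
  rewrite (intC (fun s => coefA P s 0 i)).
    by rewrite -lc summxE; congr EFin; apply: eq_bigr => j _; rewrite mxE.
  exact: continuous_coord.
have omu : (value (primal P) <= objective (dual P) mu)%E.
  by rewrite -betaE /= intC// lee_fin.
have dle : (value (dual P) <= value (primal P))%E.
  apply/ereal_supP => _ [nu fnu <-]; apply/ereal_infP => _ [x fx <-].
  exact: weak_duality.
have led : (objective (dual P) mu <= value (dual P))%E.
  by apply: ereal_sup_ubound; exists mu.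
split.
- by apply/eqP; rewrite eq_le dle (le_trans omu led).
- exists (range t); split; first by move=> _ [i _ <-]; exact: Tt.
    by apply: finite_image; exact: finite_finset.
  apply/eqP; rewrite eq_le; apply/andP; split.
    apply: le_ereal_inf => _ [x fx <-]; exists x => // s [i _ <-].
    by apply: fx; exact: Tt.
  (* If [x] satisfies the constraints at the atoms, weighting them by [l] gives
     [beta <= dotmul (coefc P) x]. *)
  apply/ereal_infP => _ [x fx <-]; rewrite -betaE lee_fin (le_trans lb)//.
  rewrite -lc dotmul_suml; apply: ler_sum => i _; apply: ler_wpM2l => //.
  by rewrite -subr_le0; apply: fx; exists i.
- exists mu; split.
    by split => //; apply/eqP; rewrite eq_le led (le_trans dle omu).
  exists (range t); split; last by apply: muN => i; apply; exists i.
  apply: card_le_trans (card_image_le _ _) _.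
  by have /card_eqPle[] := @card_II p.
Qed.

End strong_duality.

(** * Continuity of the integrand and compactness of the simplex *)

(* powR sends negative reals to 1; the truncation restores continuity at 0. *)
Definition pos_powR (R : realType) (a x : R) : R := Num.max x 0 `^ a.

Lemma pos_powR_continuous (R : realType) (a : R) :
  0 < a -> continuous (pos_powR a).
Proof.
move=> a0 x; have [x0|x0] := leP x 0.
  rewrite /continuous_at {2}/pos_powR max_r// powR0 ?gt_eqF//.
  apply/cvgrPdist_lt => eps eps0.
  (* On [y < eps ^ (1 / a)] the truncated power stays below [eps]. *)
  have del0 : 0 < eps `^ a^-1 by exact: powR_gt0.
  near=> y; rewrite sub0r normrN ger0_norm ?powR_ge0//.
  rewrite -[ltRHS](@powRr1 _ eps) ?ltW// -(mulVf (lt0r_neq0 a0)) powRrM.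
  apply: gt0_ltr_powR => //; rewrite ?nnegrE ?le_max ?lexx ?orbT ?powR_ge0//.
  rewrite gt_max del0 andbT; near: y.
  by apply: lt_nbhsl; exact: le_lt_trans del0.
(* Around a positive point the truncation is inactive and the power is [expR (a * ln y)]. *)
have near_pos : \forall y \near x, 0 < y by exact: lt_nbhsr.
have fE y : 0 < y -> pos_powR a y = expR (a * ln y).
  by move=> y0; rewrite /pos_powR max_l ?ltW// /powR gt_eqF.
rewrite /continuous_at fE//.
apply: (@cvg_trans _ ((fun y => expR (a * ln y)) @ x)).
  by apply: near_eq_cvg; near=> y; rewrite fE//; near: y.
apply: (continuous_comp (f := fun y => a * ln y)); last exact: continuous_expR.
apply: continuousM; first exact: cst_continuous.
exact: continuous_ln.
Unshelve. all: by end_near. Qed.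

Lemma maxcoord_continuous (R : realType) d (J : {set 'I_d}) :
  continuous (@maxcoord R d J).
Proof.
apply: continuous_big => [|i _]; first exact: max_continuous.
exact: coord_continuous.
Qed.

(** It is a closed subset of the unit cube. *)
Lemma simplex_compact (R : realType) d : compact (@simplex R d).
Proof.
pose S := [set u : 'rV[R]_d | forall i, `[0, 1]%classic (u ord0 i)].
have cS : compact S.
  apply: (@rV_compact R d (fun=> `[0, 1]%classic)) => i.
  exact: segment_compact.
apply: (subclosed_compact _ cS); last first.
  move=> u [u0 u1] i; rewrite /= in_itv/= u0 -u1 (bigD1 i)//= lerDl.
  by apply: sumr_ge0 => j _.
have -> : @simplex R d = (\bigcap_i (fun u => u 0 i) @^-1` [set x | 0 <= x]) `&`
    (fun u => \sum_i u 0 i) @^-1` [set 1].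
  apply/seteqP; split => [u [u0 u1]|u [u0 u1]]; split => // i.
    by move=> _; exact: u0.
  exact: u0.
apply: closedI.
  apply: closed_bigI => i _; apply: closed_comp; last exact: closed_ge.
  by move=> u _; exact: coord_continuous.
apply: closed_comp; last exact: closed_eq.
by move=> u _; apply: continuous_sum => j _; exact: coord_continuous.
Qed.

Lemma simplex_neq0 (R : realType) d : (0 < d)%N -> @simplex R d !=set0.
Proof.
case: d => // d _; exists (delta_mx 0 0); split=> [i|].
  by rewrite mxE ler0n.
rewrite (bigD1 0)//= big1 => [|i i0]; rewrite mxE ?eqxx ?addr0//.
by rewrite (negbTE i0).
Qed.

(** A continuous extension to the whole space of the integrand of [rho], with which it agrees on the
    simplex for non-negative [w]. *)
Definition rho_integrand (R : realType) d (w : 'I_d -> R) (xi : R)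
    (u : 'rV[R]_d) : R :=
  pos_powR (1 / xi) (\sum_i w i * pos_powR xi (u 0 i)).

Lemma rho_integrand_continuous (R : realType) d (w : 'I_d -> R) (xi : R) :
  0 < xi -> continuous (rho_integrand w xi).
Proof.
move=> xi0 u; apply: (@continuous_comp _ _ _
  (fun u : 'rV_d => \sum_i w i * pos_powR xi (u 0 i)) (pos_powR (1 / xi)));
  last first.
  by apply: pos_powR_continuous; rewrite div1r invr_gt0.
apply: continuous_sum => i _ {}u.
apply: (@continuousM R 'rV[R]_d (cst (w i))
  (fun u : 'rV[R]_d => pos_powR xi (u 0 i))).
  exact: cst_continuous.
apply: (@continuous_comp _ _ _ (fun u : 'rV_d => u 0 i)).
  exact: coord_continuous.
exact: pos_powR_continuous.
Qed.

Lemma rho_integrandE (R : realType) d (w : 'I_d -> R) (xi : R) u :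
  (forall i, 0 <= w i) -> simplex u ->
  rho_integrand w xi u = (\sum_(i < d) w i * u 0 i `^ xi) `^ (1 / xi).
Proof.
move=> w0 [u0 _]; rewrite /rho_integrand /pos_powR max_l.
  by congr (_ `^ _); apply: eq_bigr => i _; rewrite max_l.
by apply: sumr_ge0 => i _; rewrite mulr_ge0// powR_ge0.
Qed.

(** * The extremal problems as duals of semi-infinite programs *)

Section rho_lsip.
Context (R : realType) (d : nat) (w : 'I_d -> R) (xi : R).
Context (JJ : {set {set 'I_d}}) (c : {set 'I_d} -> R).
Hypotheses (w0 : forall i, 0 < w i) (xi0 : 0 < xi).

(* The sign k is 1 for the supremum and -1 for the infimum. *)
Definition rho_lsip (k : R) : lsip R 'rV[R]_d #|JJ| :=
  Lsip (@simplex R d)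
    (fun u => \row_(i < #|JJ|) maxcoord (enum_val i) u)
    (fun u => k * rho_integrand w xi u)
    (\row_(i < #|JJ|) c (enum_val i)).

Lemma rho_lsip_coefA_continuous k : continuous (coefA (rho_lsip k)).
Proof.
apply: continuous_row => i; rewrite (_ : (fun _ => _) = maxcoord (enum_val i)).
  exact: maxcoord_continuous.
by apply/funext => u; rewrite mxE.
Qed.

Lemma rho_lsip_coefb_continuous k : continuous (coefb (rho_lsip k)).
Proof.
move=> u; apply: (@continuousM R 'rV[R]_d (cst k) (rho_integrand w xi)).
  exact: cst_continuous.
exact: rho_integrand_continuous.
Qed.

Lemma rho_lsip_feasible k : moment_class JJ c = feasible (dual (rho_lsip k)).
Proof.
apply/seteqP; split=> H [HT HJ]; split=> //.
  move=> i; rewrite mxE -HJ ?enum_valP//.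
  by apply: eq_integral => u _; rewrite mxE.
move=> J JJJ; have := HJ (enum_rank_in JJJ J).
rewrite mxE enum_rankK_in// => <-.
by apply: eq_integral => u _; rewrite mxE enum_rankK_in.
Qed.

Lemma rho_lsip_upper : upper_problem w xi JJ c = dual (rho_lsip 1).
Proof.
rewrite /upper_problem /rho_problem (rho_lsip_feasible 1); congr Problem.
apply/funext => H; apply: eq_integral => u /set_mem su.
by congr EFin; rewrite [RHS]mul1r rho_integrandE// => i; rewrite ltW.
Qed.

Lemma rho_lsip_lower : lower_problem w xi JJ c = negated (dual (rho_lsip (-1))).
Proof.
rewrite /lower_problem /rho_problem (rho_lsip_feasible (-1)); congr Problem.
apply/funext => H; rewrite /=.
under [in RHS]eq_integral do rewrite mulN1r EFinN.
(* The sign leaves the integral because the integrand is non-negative. *)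
rewrite integral_ge0N ?oppeK => [|u _]; last by rewrite lee_fin powR_ge0.
apply: eq_integral => u /set_mem su.
by rewrite rho_integrandE// => i; rewrite ltW.
Qed.

(** This supplies the vector [e] of the duality theorem: pairing with the all-ones vector sums
    [maxcoord J u] over [JJ]. *)
Lemma rho_lsip_normalized k (u : 'rV[R]_d) :
  (forall u : 'rV[R]_d, simplex u -> \sum_(j < d) u 0 j = 1 /\
        \sum_(j < d) u 0 j < \sum_(J in JJ) maxcoord J u) ->
  simplex u -> 1 <= dotmul (coefA (rho_lsip k) u) (const_mx 1).
Proof.
move=> hlt su; have [u1] := hlt u su; rewrite u1 => /ltW.
rewrite big_enum_val/= => /le_trans; apply.
by apply: ler_sum => i _; rewrite !mxE mulr1.
Qed.

End rho_lsip.

(** * Change of sign and proof of the theorem *)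

Lemma value_negated (R : realType) (X : Type) (Q : problem R X) :
  value (negated Q) = (- value Q)%E.
Proof.
case: Q => -[] F f; rewrite /value /= -?ereal_supN -?ereal_infN.
  by rewrite -(image_comp f).
by rewrite -(image_comp f).
Qed.

Lemma solutions_negated (R : realType) (X : Type) (Q : problem R X) :
  solutions (negated Q) = solutions Q.
Proof.
apply/seteqP; split=> x [Fx ox]; split => //.
  by apply: oppe_inj; rewrite -value_negated.
by rewrite value_negated /= ox.
Qed.

Theorem theorem3p1 (R : realType) (d : nat) (hd : (0 < d)%N)
    (xi : R) (hxi : 0 < xi <= 1)
    (w : 'I_d -> R) (hw : forall i, 0 < w i)
    (JJ : {set {set 'I_d}}) (hJJ : forall J, J \in JJ -> J != finset.set0)
    (c : {set 'I_d} -> R) (hc : forall J, J \in JJ -> 0 <= c J)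
    (hext : exists H0 : {finite_measure set (borel_rV R d) -> \bar R},
        carried_by H0 (@simplex R d) /\
        forall J, J \in JJ -> (c J)%:E = extremal_integral H0 J)
    (hsing : forall j : 'I_d, finset.set1 j \in JJ /\ c (finset.set1 j) = 1)
    (hlt : forall u, @simplex R d u ->
        \sum_(j < d) u 0 j = 1 /\
        \sum_(j < d) u 0 j < \sum_(J in JJ) maxcoord J u) :
  (exists (p : nat) (P : lsip R 'rV[R]_d p),
      let L := lower_problem w xi JJ c in
      let L' := negated (primal P) in
      L = negated (dual P) /\
      [/\ compact (index_set P),
          {within index_set P, continuous (coefA P)} /\
          {within index_set P, continuous (coefb P)} &
          [bounded coefA P t | t in index_set P] /\
          [bounded coefb P t | t in index_set P]] /\
      slater P /\
      value L' \is a fin_num /\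
      strong_duality L' L /\
      reducible P /\
      exists H, solutions L H /\ supported_on_atoms H #|JJ|) /\
  (exists (p : nat) (P : lsip R 'rV[R]_d p),
      let U := upper_problem w xi JJ c in
      let U' := primal P in
      U = dual P /\
      [/\ compact (index_set P),
          {within index_set P, continuous (coefA P)} /\
          {within index_set P, continuous (coefb P)} &
          [bounded coefA P t | t in index_set P] /\
          [bounded coefb P t | t in index_set P]] /\
      slater P /\
      value U' \is a fin_num /\
      strong_duality U' U /\
      reducible P /\
      exists H, solutions U H /\ supported_on_atoms H #|JJ|).
Proof.
have [xi0 _] := andP hxi.
have [H0 [H0S H0c]] := hext.
pose P := rho_lsip w xi JJ c.
have cT k : compact (index_set (P k)) by exact: simplex_compact.
have T0 k : index_set (P k) !=set0 by exact: simplex_neq0.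
have cA k : continuous (coefA (P k)) by exact: rho_lsip_coefA_continuous.
have cb k : continuous (coefb (P k)) by exact: rho_lsip_coefb_continuous.
have he k u : index_set (P k) u -> 1 <= dotmul (coefA (P k) u) (const_mx 1).
  exact: rho_lsip_normalized.
(* The measure that realizes the extremal coefficients is the dual feasible point, for either
   sign. *)
have fH0 k : feasible (dual (P k)) H0.
  by rewrite -rho_lsip_feasible; split=> // J /H0c.
have regular k :
    [/\ compact (index_set (P k)),
        {within index_set (P k), continuous (coefA (P k))} /\
        {within index_set (P k), continuous (coefb (P k))} &
        [bounded coefA (P k) t | t in index_set (P k)] /\
        [bounded coefb (P k) t | t in index_set (P k)]].
  split; first exact: cT.
    by split; apply: continuous_subspaceT; [exact: cA|exact: cb].
  by split; apply: continuous_compact_bounded.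
have sl k := lsip_slater (cT k) (cb k) (he k).
have fin k := lsip_value_fin_num (cT k) (cA k) (cb k) (he k) (fH0 k).
have sd k := lsip_strong_duality (cT k) (T0 k) (cA k) (cb k) (he k) (fH0 k).
split.
- exists #|JJ|, (P (-1)).
  have [eqv red [mu [smu amu]]] := sd (-1).
  split; first exact: rho_lsip_lower.
  (* Negation reverses the values and keeps the solutions, so the lower problem inherits the duality
     of [P (-1)]. *)
  rewrite rho_lsip_lower// /strong_duality !value_negated !solutions_negated.
  rewrite fin_numN eqv.
  split; first exact: regular.
  split; first exact: sl.
  split; first by rewrite -eqv.
  split; first by split => //; exists mu.
  by split=> //; exists mu.
- exists #|JJ|, (P 1).
  have [eqv red [mu [smu amu]]] := sd 1.
  split; first exact: rho_lsip_upper.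
  rewrite rho_lsip_upper//.
  split; first exact: regular.
  split; first exact: sl.
  split; first exact: fin.
  split; first by split => //; exists mu.
  by split=> //; exists mu.
Qed.
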